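(* Let $\mathcal{A}$ be a cellular automaton with alphabet $Q$ and $\mu$ a shift-invariant Borel probability measure on $Q^{\mathbb{Z}}$. Then: (i) if $\mu$ is computable, $L_\mu(\mathcal{A})$ is a $\Sigma_3^0$ set; (ii) if $\mu$ is shift-ergodic with full support and $\mathcal{A}$ has an equicontinuity point, then $L_\mu(\mathcal{A})$ is recursively enumerable.
   Context: A CA $\mathcal{A}$ over finite alphabet $Q$ has radius $r$ and local rule $\delta:Q^{2r+1}\to Q$, global map $\mathcal{A}(c)_z=\delta(c_{z-r},\dots,c_{z+r})$. With $[u]_0=\{c:c_{[0,|u|-1]}=u\}$ and $\mathcal{A}^t\mu([u]_0)=\mu(\mathcal{A}^{-t}([u]_0))$, $L_\mu(\mathcal{A})=\{u\in Q^*:\mathcal{A}^t\mu([u]_0)\not\to0\}$. $\mu$ is computable if there is a computable $f:Q^*\times\mathbb{Q}\to\mathbb{Q}$ with $|\mu([u]_0)-f(u,\epsilon)|\le\epsilon$ for all $u$ and rational $\epsilon>0$. $\mu$ is shift-ergodic if every shift-invariant measurable set has measure 0 or 1; full support means $\mu([u]_0)>0$ for every word $u$. An equicontinuity point is a configuration $x$ such that for every $\epsilon>0$ there is $\delta>0$ with $d(x,y)<\delta\Rightarrow d(\mathcal{A}^t x,\mathcal{A}^t y)<\epsilon$ for all $t$ (product topology metric on $Q^{\mathbb{Z}}$). *)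

(* Defs.v *)
From HB Require Import structures.
From mathcomp Require Import all_boot all_order all_algebra.
From mathcomp Require Import all_classical all_reals.
From mathcomp Require Import ereal topology normedtype sequences measure probability.

Unset Printing Implicit Defensive.

Import Order.TTheory GRing.Theory Num.Theory.
Local Open Scope classical_set_scope.
Local Open Scope ring_scope.

Inductive prf : Type :=
| PZero
| PSucc
| PProj of nat
| PComp of prf & seq prf
| PRec of prf & prf
| PMin of prf.

Inductive peval : prf -> seq nat -> nat -> Prop :=
| ev_zero v : peval PZero v 0
| ev_succ v : peval PSucc v (head 0%N v).+1
| ev_proj i v : peval (PProj i) v (nth 0%N v i)
| ev_comp f gs v ws y :
    pevals gs v ws -> peval f ws y -> peval (PComp f gs) v y
| ev_rec0 f g v y : peval f v y -> peval (PRec f g) (0%N :: v) y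
| ev_recS f g n v z y :
    peval (PRec f g) (n :: v) z -> peval g (n :: z :: v) y ->
    peval (PRec f g) (n.+1 :: v) y
| ev_min f v n :
    peval f (n :: v) 0 ->
    (forall m, (m < n)%N -> exists k, peval f (m :: v) k.+1) ->
    peval (PMin f) v n
with pevals : seq prf -> seq nat -> seq nat -> Prop :=
| evs_nil v : pevals [::] v [::]
| evs_cons g gs v w ws :
    peval g v w -> pevals gs v ws -> pevals (g :: gs) v (w :: ws).

Definition cpair (a b : nat) : nat := ((a + b) * (a + b).+1)./2 + b.

Fixpoint listcode (s : seq nat) : nat :=
  match s with
  | [::] => 0
  | x :: s' => (cpair x (listcode s')).+1
  end.

Definition wordcode {Q : finType} (u : seq Q) : nat :=
  listcode (map (fun a => nat_of_ord (enum_rank a)) u).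

Definition intcode (z : int) : nat :=
  match z with Posz n => n.*2 | Negz n => n.*2.+1 end.

Definition ratcode (q : rat) : nat :=
  cpair (intcode (numq q)) (absz (denq q)).

Definition Sigma03_words {Q : finType} (L : seq Q -> Prop) : Prop :=
  exists Rel : nat -> nat -> nat -> nat -> bool,
    (exists p : prf, forall n a b c,
        peval p [:: n; a; b; c] (nat_of_bool (Rel n a b c))) /\
    (forall u, L u <-> exists a, forall b, exists c, Rel (wordcode u) a b c).

Definition RE_words {Q : finType} (L : seq Q -> Prop) : Prop :=
  exists p : prf, forall u, L u <-> exists y, peval p [:: wordcode u] y.

(* The point q0 of the (nonempty) alphabet only serves to equip Q^Z with
   the pointedType structure required by mathcomp-analysis. *)
Record conf {Q : finType} (q0 : Q) : Type := Conf { cval :> int -> Q }.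
Arguments Conf {Q q0} cval.

HB.instance Definition _ (Q : finType) (q0 : Q) := gen_eqMixin (conf q0).
HB.instance Definition _ (Q : finType) (q0 : Q) := gen_choiceMixin (conf q0).
HB.instance Definition _ (Q : finType) (q0 : Q) :=
  isPointed.Build (conf q0) (Conf (fun _ => q0)).

Definition cyl_at {Q : finType} (q0 : Q) (i : int) (u : seq Q) : set (conf q0) :=
  [set c | forall k : 'I_(size u), c (i + (nat_of_ord k)%:Z) = tnth (in_tuple u) k].

Definition cyl0 {Q : finType} (q0 : Q) (u : seq Q) : set (conf q0) := cyl_at q0 0 u.

Definition cylinders {Q : finType} (q0 : Q) : set (set (conf q0)) :=
  [set A | exists i u, A = cyl_at q0 i u].

(* Q^Z with the sigma-algebra generated by cylinders (= Borel sigma-algebra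
   of the product topology) *)
Definition QZ {Q : finType} (q0 : Q) := g_sigma_algebraType (cylinders q0).

Definition ca_global {Q : finType} {q0 : Q} {r : nat}
    (delta : (r.*2.+1).-tuple Q -> Q) (c : QZ q0) : QZ q0 :=
  Conf (fun z => delta [tuple c (z - r%:Z + (nat_of_ord i)%:Z) | i < r.*2.+1]).

Definition sshift {Q : finType} {q0 : Q} (c : QZ q0) : QZ q0 :=
  Conf (fun z => c (z + 1)).

Definition shift_invariant {Q : finType} {q0 : Q} {R : realType}
    (mu : probability (QZ q0) R) : Prop :=
  forall A : set (QZ q0), measurable A -> mu (sshift (q0:=q0) @^-1` A) = mu A.

Definition shift_ergodic {Q : finType} {q0 : Q} {R : realType}
    (mu : probability (QZ q0) R) : Prop :=
  forall A : set (QZ q0), measurable A -> sshift (q0:=q0) @^-1` A = A ->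
    mu A = 0%E \/ mu A = 1%E.

Definition full_support {Q : finType} {q0 : Q} {R : realType}
    (mu : probability (QZ q0) R) : Prop :=
  forall u : seq Q, (0 < mu (cyl0 q0 u))%E.

Definition computable_measure {Q : finType} {q0 : Q} {R : realType}
    (mu : probability (QZ q0) R) : Prop :=
  exists p : prf, forall (u : seq Q) (eps : rat), 0 < eps ->
    exists q : rat, peval p [:: wordcode u; ratcode eps] (ratcode q) /\
      (`| mu (cyl0 q0 u) - (ratr q : R)%:E | <= (ratr eps : R)%:E)%E.

Definition limit_language {Q : finType} {q0 : Q} {r : nat}
    (delta : (r.*2.+1).-tuple Q -> Q) {R : realType}
    (mu : probability (QZ q0) R) (u : seq Q) : Prop :=
  ~ ((fun t : nat => mu (iter t (ca_global delta) @^-1` cyl0 q0 u))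
       @ \oo --> (0%E : \bar R)).

(* x is an equicontinuity point (product topology on Q^Z, Cantor metric
   d(x,y) = 2^{-min{|i| : x_i <> y_i}}): for every radius n there is a
   radius m such that agreement with x on [-m,m] implies agreement of all
   iterates with those of x on [-n,n]. *)
Definition equicontinuity_point {Q : finType} {q0 : Q} {r : nat}
    (delta : (r.*2.+1).-tuple Q -> Q) (x : QZ q0) : Prop :=
  forall n : nat, exists m : nat, forall y : QZ q0,
    (forall i : int, `|i| <= m%:Z -> y i = x i) ->
    forall (t : nat) (i : int), `|i| <= n%:Z ->
      iter t (ca_global delta) y i = iter t (ca_global delta) x i.

(* Main.v *)
Require Import Defs.
From HB Require Import structures.
From mathcomp Require Import all_boot all_order all_algebra.
From mathcomp Require Import all_classical all_reals.
From mathcomp Require Import ereal topology normedtype sequences measure probability.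
From mathcomp Require Import zify ring lra.

(* Words of length l are the numbers N < q^l in base q = #|Q|, and the automaton
   acts on cyclic words of length l, i.e. on spatially periodic configurations.

   (i) By shift invariance mu(A^-t [u]) is the sum of mu [v] over the words v of
   length |u| + 2rt + 1 that produce u after t steps, so it is computable from
   mu, uniformly in t. Hence "limsup_t mu(A^-t [u]) > 0" reads "there is a such
   that for all b there is t >= b with an approximation of mu(A^-t [u]) above a
   threshold of order 1/a".

   (ii) Let w = x[-m, m] be a blocking word given by an equicontinuity point x. In
   a configuration carrying two copies of w, everything between them evolves as
   in the periodic extension of the pattern w...w, hence eventually periodically.
   By ergodicity and full support almost every configuration carries w
   infinitely often on both sides of the origin, so u is in the limit language
   iff some pattern N of length l delimited by two copies of w produces u between
   them at a time t >= q^l, when its orbit is already on its cycle. This is a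
   search for a finite certificate. *)

Set Implicit Arguments.
Unset Strict Implicit.
Unset Printing Implicit Defensive.
Import Order.TTheory GRing.Theory Num.Theory numFieldNormedType.Exports.

(** * Recursive functions *)

(* The generated schemes give no induction hypothesis for the evaluations that
   ev_min hides under an existential quantifier. *)
Section PevalInd.
Variables (P : prf -> seq nat -> nat -> Prop)
          (Ps : seq prf -> seq nat -> seq nat -> Prop).
Hypotheses
  (Pzero : forall v, P PZero v 0)
  (Psucc : forall v, P PSucc v (head 0 v).+1)
  (Pproj : forall i v, P (PProj i) v (nth 0 v i))
  (Pcomp : forall f gs v ws y, Ps gs v ws -> P f ws y -> P (PComp f gs) v y)
  (Prec0 : forall f g v y, P f v y -> P (PRec f g) (0 :: v) y)
  (PrecS : forall f g n v z y, P (PRec f g) (n :: v) z ->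
     P g [:: n, z & v] y -> P (PRec f g) (n.+1 :: v) y)
  (Pmin : forall f v n, P f (n :: v) 0 ->
     (forall m, m < n -> exists k, P f (m :: v) k.+1) -> P (PMin f) v n)
  (Pnil : forall v, Ps [::] v [::])
  (Pcons : forall g gs v w ws, P g v w -> Ps gs v ws ->
     Ps (g :: gs) v (w :: ws)).

Fixpoint peval_full_ind p v y (H : peval p v y) : P p v y :=
  match H with
  | ev_zero v => Pzero v
  | ev_succ v => Psucc v
  | ev_proj i v => Pproj i v
  | ev_comp _ _ _ _ _ Hs Hf => Pcomp (pevals_full_ind Hs) (peval_full_ind Hf)
  | ev_rec0 _ g _ _ Hf => Prec0 g (peval_full_ind Hf)
  | ev_recS _ _ _ _ _ _ Hr Hg => PrecS (peval_full_ind Hr) (peval_full_ind Hg)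
  | ev_min _ _ _ H0 Hlt => Pmin (peval_full_ind H0) (fun m lt =>
      match Hlt m lt with ex_intro k Hk => ex_intro _ k (peval_full_ind Hk) end)
  end
with pevals_full_ind gs v ws (H : pevals gs v ws) : Ps gs v ws :=
  match H with
  | evs_nil v => Pnil v
  | evs_cons _ _ _ _ _ Hg Hgs => Pcons (peval_full_ind Hg) (pevals_full_ind Hgs)
  end.
End PevalInd.

(** Evaluation is deterministic, by induction on the derivation; [mu_search] uses it to read the
    value of the test program off a halting minimisation. *)
Lemma peval_fun p v y : peval p v y -> forall y', peval p v y' -> y = y'.
Proof.
move=> ev; apply: (peval_full_ind
  (P := fun p v y => forall y', peval p v y' -> y = y')
  (Ps := fun gs v ws => forall ws', pevals gs v ws' -> ws = ws')) ev
  => {p v y}.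
- by move=> v y' H; inversion H.
- by move=> v y' H; inversion H.
- by move=> i v y' H; inversion H.
- move=> f gs v ws y IHs IHf y' H.
  inversion H as [| | |? ? ? ? ? evs evf| | |]; subst.
  by apply: IHf; rewrite (IHs _ evs).
- by move=> f g v y IH y' H; inversion H; subst; apply: IH.
- move=> f g n v z y IHr IHg y' H.
  inversion H as [| | | | |? ? ? ? ? ? evr evg|]; subst.
  by apply: IHg; rewrite (IHr _ evr).
(* Of two distinct minima, the smaller one would make [f] evaluate both to 0 and to a successor. *)
- move=> f v n IH0 IHlt y' H; inversion H as [| | | | | |? ? ? ev0 evlt]; subst.
  case: (ltngtP n y') => // lt.
  + by have [k /IH0] := evlt _ lt.
  + by have [k /(_ _ ev0)] := IHlt _ lt.
- by move=> v ws' H; inversion H.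
- move=> g gs v w ws IHg IHgs ws' H.
  inversion H as [|? ? ? ? ? evg evgs]; subst.
  by rewrite (IHg _ evg) (IHgs _ evgs).
Qed.

(** Variables are written [nth 0 v i], and only argument lists of length [k] matter. Fixing the
    arity lets finitely many projections rebuild the whole list. *)
Definition recursive k (f : seq nat -> nat) : Prop :=
  exists p, forall v, size v = k -> peval p v (f v).

Lemma rec_ext k f g : (forall v, f v = g v) -> recursive k g -> recursive k f.
Proof. by move=> fg [p pP]; exists p => v /pP; rewrite fg. Qed.

Lemma rec_nth k i : recursive k (fun v => nth 0 v i).
Proof. by exists (PProj i) => v _; constructor. Qed.

Lemma rec_comp k (gs : seq (seq nat -> nat)) f :
  (forall i, i < size gs -> recursive k (nth (fun=> 0) gs i)) ->
  recursive (size gs) f -> recursive k (fun v => f (map (fun g => g v) gs)).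
Proof.
move=> gsP [p pP].
suff [ps psP] : exists ps, forall v, size v = k ->
    pevals ps v (map (fun g => g v) gs).
  exists (PComp p ps) => v sv; econstructor; first exact: psP.
  by apply: pP; rewrite size_map.
elim: gs gsP {pP} => [|g gs IH] gsP; first by exists [::] => v _; constructor.
have [q qP] := gsP 0 isT.
have [ps psP] := IH (fun i => gsP i.+1).
by exists (q :: ps) => v sv; constructor; [exact: qP|exact: psP].
Qed.

Definition rec1 (h : nat -> nat) := recursive 1 (fun v => h (nth 0 v 0)).
Definition rec2 (h : nat -> nat -> nat) :=
  recursive 2 (fun v => h (nth 0 v 0) (nth 0 v 1)).
Definition rec3 (h : nat -> nat -> nat -> nat) :=
  recursive 3 (fun v => h (nth 0 v 0) (nth 0 v 1) (nth 0 v 2)).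
Definition rec4 (h : nat -> nat -> nat -> nat -> nat) :=
  recursive 4 (fun v => h (nth 0 v 0) (nth 0 v 1) (nth 0 v 2) (nth 0 v 3)).

Lemma rec_comp1 k h a :
  rec1 h -> recursive k a -> recursive k (fun v => h (a v)).
Proof. by move=> rh ra; apply: (rec_comp (gs := [:: a])) rh; case. Qed.

Lemma rec_comp2 k h a b : rec2 h -> recursive k a -> recursive k b ->
  recursive k (fun v => h (a v) (b v)).
Proof.
by move=> rh ra rb; apply: (rec_comp (gs := [:: a; b])) rh; case=> [|[]].
Qed.

Lemma rec_comp3 k h a b c :
  rec3 h -> recursive k a -> recursive k b -> recursive k c ->
  recursive k (fun v => h (a v) (b v) (c v)).
Proof.
move=> rh ra rb rc.
by apply: (rec_comp (gs := [:: a; b; c])) rh; case=> [|[|[]]].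
Qed.

Lemma rec_succ : rec1 S.
Proof. by exists PSucc => v _; rewrite nth0; constructor. Qed.

Lemma rec_const k n : recursive k (fun=> n).
Proof.
elim: n => [|n IH]; first by exists PZero => v _; constructor.
exact: rec_comp1 rec_succ IH.
Qed.

(** [PRec] recurses on the head of its argument list, so the counter [n v] is first put in front of
    [v] by composing with [n] and the [k] projections. *)
Lemma rec_primrec k (n b : seq nat -> nat) (s : seq nat -> nat -> nat -> nat) :
  recursive k n -> recursive k b ->
  recursive k.+2 (fun w => s (behead (behead w)) (nth 0 w 0) (nth 0 w 1)) ->
  recursive k (fun v => nat_rect (fun=> nat) (b v) (s v) (n v)).
Proof.
move=> rn [pb pbP] [ps psP].
have rr : recursive k.+1 (fun w =>
    nat_rect (fun=> nat) (b (behead w)) (s (behead w)) (nth 0 w 0)).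
  exists (PRec pb ps) => -[//|m v] [sv] /=.
  elim: m => [|m IH]; first by constructor; exact: pbP.
  apply: ev_recS IH _.
  by apply: psP; rewrite /= sv.
pose gs := n :: [seq nth 0^~ i | i <- iota 0 k].
have sgs : size gs = k.+1 by rewrite /= size_map size_iota.
rewrite -{}sgs in rr; case: (rec_comp (k := k) _ rr).
  case=> [//|i]; rewrite /= size_map => ilt.
  by rewrite (nth_map 0) // nth_iota ?size_iota // -(size_iota 0 k) //;
    exact: rec_nth.
move=> p pP; exists p => v sv; have := pP v sv; rewrite /=.
rewrite -map_comp; set v' := [seq _ | _ <- _]; suff -> : v' = v by [].
by rewrite /v' -sv -[RHS](mkseq_nth 0).
Qed.

Ltac rec_var := solve [
  eapply rec_ext; [let w := fresh in intro w; rewrite ?nth_behead; reflexivity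
                  | exact: rec_nth] ].

(* As classes, these predicates let [rec_solve] find the recursiveness of a head function by
   instance resolution. *)
Existing Class rec1.
Existing Class rec2.
Existing Class rec3.
Existing Class rec4.
#[global] Existing Instance rec_succ.

(** A [PRec] step receives both counter and accumulator; [j] selects the one that is used: the
    accumulator (1) in an iteration, the counter (0) in a sum. *)
Lemma rec_skip k f j :
  recursive k.+1 (fun w => f (behead w) (nth 0 w 0)) ->
  recursive k.+2 (fun w => f (behead (behead w)) (nth 0 w j)).
Proof.
case=> p pP.
pose gs := nth 0^~ j :: [seq nth 0^~ i | i <- iota 2 k].
have rp : recursive (size gs) (fun w => f (behead w) (nth 0 w 0)).
  by exists p => w; rewrite /gs /= size_map size_iota; exact: pP.
case: (rec_comp (k := k.+2) _ rp).
  case=> [|i] ilt; first exact: rec_nth.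
  move: ilt; rewrite /= size_map ltnS => ilt.
  by rewrite (nth_map 0) //; exact: rec_nth.
move=> p' pP'; exists p' => -[//|x [//|y v]] [sv].
have := pP' [:: x, y & v] (congr1 (addn 2) sv).
rewrite /gs /= -map_comp; set v' := [seq _ | _ <- _].
suff -> : v' = v by [].
rewrite /v' (iotaDl 2 0) -map_comp -sv -[RHS](mkseq_nth 0).
exact: eq_map.
Qed.

Lemma rec_iter k n f b : recursive k n -> recursive k b ->
  recursive k.+1 (fun w => f (behead w) (nth 0 w 0)) ->
  recursive k (fun v => iter (n v) (f v) (b v)).
Proof.
move=> rn rb rf.
apply: (@rec_ext _ _ (fun v => nat_rect (fun=> nat) (b v) (fun _ => f v) (n v))).
  by move=> v; elim: (n v) => //= m ->.
by apply: rec_primrec => //; exact: rec_skip.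
Qed.

Ltac rec_hook := fail.

(* rec_hook is extended below, once sums and comparisons are available. *)
Ltac rec_solve :=
  lazymatch goal with
  | |- rec1 _ => rewrite /rec1; rec_solve
  | |- rec2 _ => rewrite /rec2; rec_solve
  | |- rec3 _ => rewrite /rec3; rec_solve
  | |- rec4 _ => rewrite /rec4; rec_solve
  | |- recursive _ _ => cbv beta;
    first
    [ assumption
    | match goal with |- recursive _ (fun _ => ?c) => exact: rec_const end
    | rec_var
    | rec_hook
    | match goal with
      | |- recursive _ (fun v => iter (@?n v) (@?f v) (@?b v)) =>
          apply: (@rec_iter _ n f b); rec_solve
      | |- recursive _ (fun v => ?h (@?a v)) =>
          notypeclasses refine (@rec_comp1 _ h a _ _);
            [solve [typeclasses eauto] | rec_solve]
      | |- recursive _ (fun v => ?h (@?a v) (@?b v)) =>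
          notypeclasses refine (@rec_comp2 _ h a b _ _ _);
            [solve [typeclasses eauto] | rec_solve ..]
      | |- recursive _ (fun v => ?h (@?a v) (@?b v) (@?c v)) =>
          notypeclasses refine (@rec_comp3 _ h a b c _ _ _ _);
            [solve [typeclasses eauto] | rec_solve ..]
      end
    | idtac ]
  end.

#[global] Instance rec_pred : rec1 predn.
Proof.
apply: (@rec_ext _ _ (fun v => nat_rect (fun=> nat) 0 (fun m _ => m) (nth 0 v 0))).
  by move=> v; case: (nth 0 v 0).
by apply: rec_primrec; rec_solve.
Qed.

#[global] Instance rec_add : rec2 addn.
Proof.
apply: (@rec_ext _ _ (fun v => iter (nth 0 v 0) S (nth 0 v 1))).
  by move=> v; rewrite iter_succn addnC.
by rec_solve.
Qed.

#[global] Instance rec_mul : rec2 muln.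
Proof.
apply: (@rec_ext _ _ (fun v => iter (nth 0 v 0) (addn (nth 0 v 1)) 0)).
  by move=> v; rewrite iter_addn_0 mulnC.
by rec_solve.
Qed.

#[global] Instance rec_sub : rec2 subn.
Proof.
apply: (@rec_ext _ _ (fun v => iter (nth 0 v 1) predn (nth 0 v 0))).
  by move=> v; rewrite iter_predn.
by rec_solve.
Qed.

#[global] Instance rec_exp : rec2 expn.
Proof.
apply: (@rec_ext _ _ (fun v => iter (nth 0 v 1) (muln (nth 0 v 0)) 1)).
  by move=> v; rewrite iter_muln_1.
by rec_solve.
Qed.

(** * Bounded sums, comparisons and division *)

Definition nsum n F := \sum_(i < n) F (nat_of_ord i).

Lemma rec_nsum k n F : recursive k n ->
  recursive k.+1 (fun w => F (behead w) (nth 0 w 0)) ->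
  recursive k (fun v => nsum (n v) (F v)).
Proof.
move=> rn /(@rec_skip _ _ 0) rF.
apply: (@rec_ext _ _
  (fun v => nat_rect (fun=> nat) 0 (fun m z => z + F v m) (n v))).
  move=> v; rewrite /nsum; elim: (n v) => [|m IH]; first by rewrite big_ord0.
  by rewrite big_ord_recr /= IH.
by apply: rec_primrec => //; rec_solve.
Qed.

Lemma rec_leq k a b : recursive k a -> recursive k b ->
  recursive k (fun v => nat_of_bool (a v <= b v)).
Proof.
move=> ra rb; apply: (@rec_ext _ _ (fun v => 1 - (a v - b v))).
  by move=> v; rewrite -subn_eq0; case: (a v - b v).
by rec_solve.
Qed.

Lemma rec_andb k (P Q : seq nat -> bool) :
  recursive k (fun v => nat_of_bool (P v)) ->
  recursive k (fun v => nat_of_bool (Q v)) ->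
  recursive k (fun v => nat_of_bool (P v && Q v)).
Proof.
move=> rP rQ; apply: (@rec_ext _ _ (fun v => P v * Q v)).
  by move=> v; rewrite mulnb.
by rec_solve.
Qed.

Lemma rec_negb k (P : seq nat -> bool) :
  recursive k (fun v => nat_of_bool (P v)) ->
  recursive k (fun v => nat_of_bool (~~ P v)).
Proof.
move=> rP; apply: (@rec_ext _ _ (fun v => 1 - P v)).
  by move=> v; case: (P v).
by rec_solve.
Qed.

Lemma rec_eqn k (a b : seq nat -> nat) : recursive k a -> recursive k b ->
  recursive k (fun v => nat_of_bool (a v == b v)).
Proof.
move=> ra rb.
apply: (@rec_ext _ _ (fun v => nat_of_bool ((a v <= b v) && (b v <= a v)))).
  by move=> v; rewrite -eqn_leq.
by apply: rec_andb; apply: rec_leq.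
Qed.

Ltac rec_hook ::=
  match goal with
  | |- recursive _ (fun v => nsum (@?n v) (@?F v)) =>
      apply: (@rec_nsum _ n F); rec_solve
  | |- recursive _ (fun v => nat_of_bool (@?a v == @?b v)) =>
      apply: (@rec_eqn _ a b); rec_solve
  | |- recursive _ (fun v => nat_of_bool (leq (@?a v) (@?b v))) =>
      apply: (@rec_leq _ a b); rec_solve
  | |- recursive _ (fun v => nat_of_bool (andb (@?P v) (@?Q v))) =>
      apply: (@rec_andb _ P Q); rec_solve
  | |- recursive _ (fun v => nat_of_bool (~~ (@?P v))) =>
      apply: (@rec_negb _ P); rec_solve
  | |- recursive _ (fun v => nat_of_bool (odd (@?a v))) =>
      notypeclasses refine (@rec_comp1 _ (fun n => nat_of_bool (odd n)) a _ _);
        [solve [typeclasses eauto] | rec_solve]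
  end.

(** Lets quotients and list lengths be obtained by counting the indices that pass a test. *)
Lemma nsum_ltn n m : nsum n (fun i => i < m) = minn n m.
Proof.
rewrite /nsum; elim: n => [|n IH]; first by rewrite big_ord0 min0n.
rewrite big_ord_recr /= {}IH; case: (ltnP n m) => nm.
  by rewrite (minn_idPl nm) addn1.
by rewrite (minn_idPr (leqW nm)) addn0.
Qed.

(** The quotient of x by d counts the i < x with (i + 1) d <= x; the factor [0 < d] matches the
    convention that division by 0 gives 0. *)
#[global] Instance rec_div : rec2 divn.
Proof.
apply: (@rec_ext _ _ (fun v => (0 < nth 0 v 1) * nsum (nth 0 v 0) (fun i =>
    nat_of_bool (i.+1 * nth 0 v 1 <= nth 0 v 0)))).
  move=> v; move: (nth 0 v 0) (nth 0 v 1) => x [|d]; first by rewrite divn0.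
  rewrite -(minn_idPr (leq_div x d.+1)) -nsum_ltn mul1n /nsum.
  by apply: eq_bigr => i _; rewrite -leq_divRL.
by rec_solve.
Qed.

#[global] Instance rec_mod : rec2 modn.
Proof.
apply: (@rec_ext _ _ (fun v =>
    nth 0 v 0 - nth 0 v 0 %/ nth 0 v 1 * nth 0 v 1)).
  by move=> v; rewrite [X in X - _](divn_eq _ (nth 0 v 1)) addKn.
by rec_solve.
Qed.

#[global] Instance rec_odd : rec1 (fun n => nat_of_bool (odd n)).
Proof.
apply: (@rec_ext _ _ (fun v => nth 0 v 0 %% 2)); last by rec_solve.
by move=> v; rewrite modn2.
Qed.

#[global] Instance rec_half : rec1 half.
Proof.
apply: (@rec_ext _ _ (fun v => nth 0 v 0 %/ 2)); last by rec_solve.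
by move=> v; rewrite divn2.
Qed.

(** Any finite table is recursive; this is how the local rule enters programs. *)
#[global] Instance rec_table s : rec1 (nth 0 s).
Proof.
elim: s => [|x s IH].
  apply: (@rec_ext _ _ (fun v => 0)); last by rec_solve.
  by move=> v; rewrite nth_nil.
apply: (@rec_ext _ _ (fun v => (nth 0 v 0 == 0) * x +
    (0 < nth 0 v 0) * nth 0 s (nth 0 v 0).-1)).
  by move=> v; case: (nth 0 v 0) => [|n] /=; rewrite ?mul1n ?addn0.
by rec_solve.
Qed.

#[global] Instance rec_double : rec1 double.
Proof.
apply: (@rec_ext _ _ (fun v => nth 0 v 0 + nth 0 v 0)); last by rec_solve.
by move=> v; rewrite addnn.
Qed.

(** * Decoding pairs and lists *)

#[global] Instance rec_cpair : rec2 cpair.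
Proof. by rewrite /cpair; rec_solve. Qed.

Lemma leq_cpairl a b : a <= cpair a b.
Proof.
rewrite /cpair; apply: leq_trans (leq_addr b _); apply: leq_trans (leq_addr b a) _.
by case: (a + b) => // n; rewrite -divn2 leq_divRL // leq_mul2l.
Qed.

Lemma leq_cpairr a b : b <= cpair a b.
Proof. by rewrite /cpair leq_addl. Qed.

(** Consecutive triangular numbers differ by n + 1, so the codes on one diagonal a + b all lie below
    those on the next; within a diagonal the code determines b. *)
Lemma cpair_inj a b a' b' : cpair a b = cpair a' b' -> a = a' /\ b = b'.
Proof.
have trS n : (n.+1 * n.+2)./2 = (n * n.+1)./2 + n.+1.
  rewrite (_ : n.+1 * n.+2 = n * n.+1 + n.+1.*2).
    by rewrite halfD odd_double andbF doubleK.
  by rewrite -muln2 [n * _]mulnC -mulnDr addn2.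
have tr_mono m n : m <= n -> (m * m.+1)./2 <= (n * n.+1)./2.
  by move=> mn; apply: half_leq; apply: leq_mul.
have lt a1 b1 a2 b2 : a1 + b1 < a2 + b2 -> cpair a1 b1 < cpair a2 b2.
  move=> lt; rewrite /cpair; apply: (@leq_trans (((a1 + b1).+1 * (a1 + b1).+2)./2)).
    by rewrite trS ltn_add2l ltnS leq_addl.
  by apply: leq_trans (leq_addr _ _); exact: tr_mono.
move=> e; case: (ltngtP (a + b) (a' + b')) => [/lt|/lt|es].
- by rewrite e ltnn.
- by rewrite e ltnn.
move: e; rewrite /cpair es => /eqP; rewrite eqn_add2l => /eqP eb.
by split=> //; move: es; rewrite eb => /eqP; rewrite eqn_add2r => /eqP.
Qed.

(** Bounded search written as a sum: both components are at most the code, and for the code of a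
    pair exactly one term survives. *)
Definition cfst z :=
  nsum z.+1 (fun a => nsum z.+1 (fun b => (cpair a b == z) * a)).
Definition csnd z :=
  nsum z.+1 (fun a => nsum z.+1 (fun b => (cpair a b == z) * b)).

#[global] Instance rec_cfst : rec1 cfst.
Proof. by rewrite /cfst; rec_solve. Qed.

#[global] Instance rec_csnd : rec1 csnd.
Proof. by rewrite /csnd; rec_solve. Qed.

Lemma nsum_cpair a b f : let z := cpair a b in
  nsum z.+1 (fun a' => nsum z.+1 (fun b' => (cpair a' b' == z) * f a' b')) =
  f a b.
Proof.
move=> z; have az : a < z.+1 by rewrite ltnS leq_cpairl.
have bz : b < z.+1 by rewrite ltnS leq_cpairr.
rewrite /nsum (bigD1 (Ordinal az)) //= (bigD1 (Ordinal bz)) //= eqxx mul1n.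
rewrite !big1 ?addn0 // => i.
  move=> /eqP ia; apply: big1 => j _; case: eqP => // /cpair_inj [ea _].
  by case: ia; apply: val_inj.
by move=> /eqP ib; case: eqP => // /cpair_inj [_ eb]; case: ib; apply: val_inj.
Qed.

Lemma cpairKl a b : cfst (cpair a b) = a.
Proof. exact: (nsum_cpair a b (fun a _ => a)). Qed.

Lemma cpairKr a b : csnd (cpair a b) = b.
Proof. exact: (nsum_cpair a b (fun _ b => b)). Qed.

Definition ltail n := csnd n.-1.
Definition lnth n k := cfst (iter k ltail n).-1.
(** Counts the tails that are nonempty, i.e. have a positive code; the code itself bounds the
    length. *)
Definition llen n := nsum n (fun i => 0 < iter i ltail n).

#[global] Instance rec_ltail : rec1 ltail.
Proof. by rewrite /ltail; rec_solve. Qed.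

#[global] Instance rec_lnth : rec2 lnth.
Proof. by rewrite /lnth; rec_solve. Qed.

#[global] Instance rec_llen : rec1 llen.
Proof. by rewrite /llen; rec_solve. Qed.

Lemma iter_ltail s k : iter k ltail (listcode s) = listcode (drop k s).
Proof.
elim: k s => [|k IH] s; first by rewrite drop0.
rewrite iterSr; case: s => [|x s].
  (* The empty list is its own tail, because [cpair 0 0] is 0. *)
  by rewrite (_ : ltail _ = listcode [::]) ?IH // -[RHS](cpairKr 0 0).
by rewrite {2}/ltail /= cpairKr IH.
Qed.

Lemma lnth_listcode s k : lnth (listcode s) k = nth 0 s k.
Proof.
rewrite /lnth iter_ltail -[k in RHS]addn0 -nth_drop.
by case: (drop k s) => [|x t] /=; [exact: (cpairKl 0 0)|rewrite cpairKl].
Qed.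

Lemma llen_listcode s : llen (listcode s) = size s.
Proof.
have le : size s <= listcode s.
  elim: s => //= x s IH; rewrite ltnS; exact: leq_trans IH (leq_cpairr _ _).
rewrite -[RHS](minn_idPr le) -nsum_ltn; apply: eq_bigr => i _.
rewrite iter_ltail -[i < _]subn_gt0 -size_drop.
by case: (drop i s).
Qed.

(** Unbounded search for a witness. [PMin] looks for a zero, hence the program [p] for the negated
    test. *)
Lemma mu_search (f : nat -> nat -> bool) : rec2 (fun y n => f y n) ->
  exists p, forall n, (exists y, f y n) <-> exists y, peval p [:: n] y.
Proof.
move=> rf; have [p pP] : rec2 (fun y n => ~~ f y n) by rec_solve.
exists (PMin p) => n; split=> [ex|[y ev]].
  exists (ex_minn ex); case: ex_minnP => y fy ymin.
  apply: ev_min => [|m my]; first by have := pP [:: y; n] erefl; rewrite /= fy.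
  exists 0; have := pP [:: m; n] erefl; rewrite /=.
  by case fm: (f m n) => //; have := ymin _ fm; rewrite leqNgt my.
inversion ev as [| | | | | |? ? ? ev0 _]; subst; exists y.
have := peval_fun (pP [:: y; n] erefl) ev0.
by rewrite /=; case: (f y n).
Qed.

(** * Cyclic words and periodic configurations *)

(** Digits are numbered from the least significant one, which is the first letter of the word. *)
Definition dig q N i := (N %/ q ^ i) %% q.

Lemma nsumS n F : nsum n.+1 F = F 0 + nsum n (fun i => F i.+1).
Proof. by rewrite /nsum big_ord_recl. Qed.

Lemma eq_nsum n F G : (forall i, i < n -> F i = G i) -> nsum n F = nsum n G.
Proof. by move=> FG; apply: eq_bigr => i _; exact: FG. Qed.

Lemma nsum_expS q n d :
  nsum n.+1 (fun i => d i * q ^ i) = d 0 + nsum n (fun i => d i.+1 * q ^ i) * q.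
Proof.
rewrite nsumS muln1; congr (_ + _); rewrite /nsum big_distrl /=.
by apply: eq_bigr => i _; rewrite expnSr mulnA.
Qed.

Lemma dig_nsum q n d j : (forall i, i < n -> d i < q) -> j < n ->
  dig q (nsum n (fun i => d i * q ^ i)) j = d j.
Proof.
elim: n d j => // n IH d j dq jn; rewrite nsum_expS.
have q0 : 0 < q by apply: leq_ltn_trans (dq 0 _).
case: j jn => [|j] jn; rewrite /dig.
  by rewrite divn1 addnC modnMDl modn_small // dq.
rewrite expnS divnMA addnC divnMDl // (divn_small (m := d 0)) ?dq // addn0.
by apply: (IH (fun i => d i.+1)) => // i ilt; exact: dq.
Qed.

Lemma nsum_dig_lt q n d : (forall i, i < n -> d i < q) ->
  nsum n (fun i => d i * q ^ i) < q ^ n.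
Proof.
elim: n d => [|n IH] d dq; first by rewrite /nsum big_ord0.
rewrite nsum_expS expnSr.
have lt := IH (fun i => d i.+1) (fun i => dq i.+1).
apply: (@leq_trans (q + nsum n (fun i => d i.+1 * q ^ i) * q)).
  by rewrite ltn_add2r dq.
by rewrite -mulSn leq_mul2r lt orbT.
Qed.

Lemma nsum_dig q n N : N < q ^ n -> nsum n (fun i => dig q N i * q ^ i) = N.
Proof.
elim: n N => [|n IH] N Nlt.
  by rewrite /nsum big_ord0; case: N Nlt.
rewrite nsum_expS {1}/dig divn1 [RHS](divn_eq N q) addnC; congr (_ * _ + _).
rewrite -[RHS](IH (N %/ q)).
  by apply: eq_nsum => i _; rewrite /dig expnS divnMA.
case: q Nlt {IH} => [|q] Nlt; first by rewrite expnS in Nlt.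
by rewrite ltn_divLR // -expnSr.
Qed.

Section Words.
Variables (Q : finType) (q0 : Q).
Local Notation q := #|Q|.

Definition letter d := nth q0 (enum Q) d.
Definition rank (a : Q) : nat := enum_rank a.

Lemma rank_lt a : rank a < q. Proof. exact: ltn_ord. Qed.

Lemma alphabet_gt0 : 0 < q. Proof. by apply: leq_ltn_trans (rank_lt q0). Qed.

Lemma rankK a : letter (rank a) = a. Proof. exact: nth_enum_rank. Qed.

Lemma letterK d : d < q -> rank (letter d) = d.
Proof.
move=> dq; rewrite /rank /letter -[d]/(nat_of_ord (Ordinal dq)).
by rewrite -(enum_val_nth q0) enum_valK.
Qed.

Lemma dig_lt N i : dig q N i < q. Proof. exact: ltn_pmod alphabet_gt0. Qed.

Definition word l N := [seq letter (dig q N k) | k <- iota 0 l].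

Lemma size_word l N : size (word l N) = l.
Proof. by rewrite size_map size_iota. Qed.

Lemma nth_word l N k : k < l -> nth q0 (word l N) k = letter (dig q N k).
Proof. by move=> kl; rewrite (nth_map 0) ?size_iota // nth_iota. Qed.

Lemma word_inj l N N' : N < q ^ l -> N' < q ^ l -> word l N = word l N' -> N = N'.
Proof.
move=> Nl Nl' e; rewrite -(nsum_dig Nl) -(nsum_dig Nl').
apply: eq_nsum => i il; congr (_ * _).
by rewrite -(letterK (dig_lt N i)) -(letterK (dig_lt N' i)) -!(nth_word _ il) e.
Qed.

Lemma word_surj (u : seq Q) : exists2 N, N < q ^ size u & word (size u) N = u.
Proof.
pose d i := rank (nth q0 u i).
exists (nsum (size u) (fun i => d i * q ^ i)).
  by apply: nsum_dig_lt => i _; exact: rank_lt.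
apply: (@eq_from_nth _ q0); rewrite size_word // => i il.
by rewrite nth_word // dig_nsum ?rankK // => j _; exact: rank_lt.
Qed.

(** A list code is built from its last element, so step m prepends the letter at position l - m -
    1. *)
Definition numcode l N :=
  nat_rect (fun=> nat) 0 (fun m z => (cpair (dig q N (l - m.+1)) z).+1) l.

Lemma numcodeE l N : numcode l N = wordcode (word l N).
Proof.
rewrite /wordcode /word -map_comp (eq_map (g := dig q N)); last first.
  by move=> k /=; exact: letterK (dig_lt N k).
rewrite /numcode.
suff H m : m <= l -> nat_rect (fun=> nat) 0
    (fun m z => (cpair (dig q N (l - m.+1)) z).+1) m =
    listcode [seq dig q N i | i <- iota (l - m) m].
  by rewrite H // subnn.
elim: m => //= m IH ml; rewrite IH; last exact: ltnW.
by rewrite -subSn.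
Qed.

#[global] Instance rec_dig : rec2 (dig q).
Proof. by rewrite /dig; rec_solve. Qed.

#[global] Instance rec_numcode : rec2 numcode.
Proof. by apply: rec_primrec; rec_solve. Qed.

(** * Action of the automaton on periodic configurations *)

Variables (r : nat) (delta : (r.*2.+1).-tuple Q -> Q).
Local Notation A := (ca_global (q0 := q0) delta).
Local Open Scope ring_scope.

Definition agree (a b : int) (c c' : QZ q0) :=
  forall z, a <= z <= b -> c z = c' z.

Lemma ca_local (c c' : QZ q0) z z' :
  (forall k : int, - r%:Z <= k <= r%:Z -> c (z + k) = c' (z' + k)) ->
  A c z = A c' z'.
Proof.
move=> cc'; congr (delta _); apply: eq_mktuple => i.
by rewrite -!addrA; apply: cc'; have := ltn_ord i; lia.
Qed.

Lemma agree_iter t a b c c' : agree a b c c' ->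
  agree (a + (r * t)%N%:Z) (b - (r * t)%N%:Z) (iter t A c) (iter t A c').
Proof.
move=> cc'; elim: t => [|t IH] z zab; first by apply: cc'; lia.
by apply: ca_local => k kr; apply: IH; lia.
Qed.

Definition shiftz (p : int) (c : QZ q0) : QZ q0 := Conf (fun z => c (z + p)).

Lemma confP (c c' : QZ q0) : (forall z, c z = c' z) -> c = c'.
Proof. by case: c c' => [c] [c'] /= /funext ->. Qed.

Lemma ca_shiftz p c : A (shiftz p c) = shiftz p (A c).
Proof.
apply: confP => z /=; congr (delta _); apply: eq_mktuple => i.
by congr (c _); ring.
Qed.

Lemma iter_shiftz t p c : iter t A (shiftz p c) = shiftz p (iter t A c).
Proof. by elim: t => //= t ->; rewrite ca_shiftz. Qed.

Definition per l N : QZ q0 :=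
  Conf (fun z => letter (dig q N `|(z %% l%:Z)%Z|%N)).

Local Close Scope ring_scope.

(** The local rule as a finite list, indexed by the base-q number of the neighbourhood. *)
Definition rule_table := [seq rank (delta [tuple letter (dig q n i) | i < r.*2.+1])
  | n <- iota 0 (q ^ r.*2.+1)].

(** One step on cyclic words. Adding the multiple [r * l] of the length keeps the subtraction of [r]
    from being truncated at 0. *)
Definition cyc l N := nsum l (fun i => nth 0 rule_table
  (nsum r.*2.+1 (fun k => dig q N ((i + r * l + k - r) %% l) * q ^ k)) * q ^ i).

#[global] Instance rec_cyc : rec2 cyc.
Proof. by rewrite /cyc; rec_solve. Qed.

Lemma nth_rule_table n : nth 0 rule_table n < q.
Proof.
have [lt|ge] := ltnP n (size rule_table); last by rewrite nth_default ?alphabet_gt0.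
by case/mapP: (mem_nth 0 lt) => m _ ->; exact: rank_lt.
Qed.

Lemma rule_tableE d : (forall k, k < r.*2.+1 -> d k < q) ->
  nth 0 rule_table (nsum r.*2.+1 (fun k => d k * q ^ k)) =
  rank (delta [tuple letter (d (nat_of_ord i)) | i < r.*2.+1]).
Proof.
move=> dq; have lt := nsum_dig_lt dq.
rewrite (nth_map 0) ?size_iota // nth_iota // add0n.
congr (rank (delta _)); apply: eq_mktuple => i.
by rewrite dig_nsum.
Qed.

Lemma cyc_lt l N : cyc l N < q ^ l.
Proof. by apply: nsum_dig_lt => i _; exact: nth_rule_table. Qed.

Lemma ca_per l N : 0 < l -> A (per l N) = per l (cyc l N).
Proof.
move=> l0; apply: confP => z /=.
have l0' : (l%:Z != 0)%R by lia.
have jl : absz (z %% Posz l)%Z < l.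
  by have := modz_ge0 z l0'; have := ltz_pmod z (d := Posz l); lia.
rewrite /cyc (dig_nsum (d := fun i => nth 0 rule_table (nsum r.*2.+1
  (fun k => dig q N ((i + r * l + k - r) %% l) * q ^ k)))) //; last first.
  by move=> i _; exact: nth_rule_table.
rewrite rule_tableE; last by move=> k _; exact: dig_lt.
rewrite rankK; congr (delta _); apply: eq_mktuple => i.
congr (letter (dig q N _)).
apply/eqP; rewrite -eqz_nat; apply/eqP.
rewrite -modz_nat gez0_abs; last exact: modz_ge0.
have -> : Posz (absz (z %% Posz l)%Z + r * l + i - r) =
  ((z %% Posz l)%Z + (Posz i - r%:Z) + r%:Z * l%:Z)%R.
  have rl : r <= r * l by rewrite leq_pmulr.
  have := modz_ge0 z l0'; rewrite -PoszM; move: (r * l)%N rl => rl rll; lia.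
rewrite [(_ + Posz r * _)%R]addrC modzMDl modzDml; congr ((_ %% _)%Z); lia.
Qed.

Lemma iter_ca_per l N t : 0 < l -> iter t A (per l N) = per l (iter t (cyc l) N).
Proof. by move=> l0; elim: t => //= t ->; rewrite ca_per. Qed.

Lemma per_nat l N i : i < l -> per l N (Posz i) = letter (dig q N i).
Proof. by move=> il /=; rewrite modz_nat modn_small. Qed.

Lemma iter_cyc_lt l N t : N < q ^ l -> iter t (cyc l) N < q ^ l.
Proof. by case: t => //= t _; exact: cyc_lt. Qed.

(* Among the first q^l + 1 states two coincide, so from time q^l on the orbit is
   on its cycle. *)
Lemma cyc_recurrent l N t : N < q ^ l -> q ^ l <= t ->
  exists2 P, 0 < P &
    forall j, iter (t + j * P) (cyc l) N = iter t (cyc l) N.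
Proof.
move=> Nl tl.
pose f (i : 'I_(q ^ l).+1) := Ordinal (iter_cyc_lt i Nl).
have /injectivePn [a [b ab fab]] : ~~ injectiveb f.
  apply/negP => /injectiveP /leq_card; by rewrite !card_ord ltnn.
wlog lt : a b ab fab / a < b.
  move=> H; case: (ltngtP a b) => [|ba|/val_inj /eqP].
  - exact: H ab fab.
  - by apply: (H b a) => //; rewrite eq_sym.
  - by rewrite (negbTE ab).
have e : iter a (cyc l) N = iter b (cyc l) N by have := congr1 val fab.
have shift s : a <= s -> iter (s + (b - a)) (cyc l) N = iter s (cyc l) N.
  move=> as_; have -> : s + (b - a) = (s - a) + b by lia.
  by rewrite iterD -e -iterD subnK.
exists (b - a); first by rewrite subn_gt0.
elim=> [|j IH]; first by rewrite addn0.
rewrite mulSn addnCA addnC shift //.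
by have := ltn_ord a; lia.
Qed.
End Words.

(** * Measures of cylinders *)

Section Reals.
Variable R : realType.
Local Open Scope classical_set_scope.
Local Open Scope ring_scope.

(** Thresholds 1/(a + 1) suffice for the positive reals, so failing to tend to 0 becomes an
    exists-forall-exists statement over naturals, the shape of a third-level set. *)
Lemma not_cvge0P (f : nat -> \bar R) (g : nat -> R) :
  (forall t, f t = (g t)%:E) -> (forall t, 0 <= g t) ->
  ~ (f @ \oo --> (0%E : \bar R)) <->
  exists a : nat, forall b, exists2 c, (b <= c)%N & a.+1%:R^-1 <= g c.
Proof.
move=> fg g0; have -> : f = EFin \o g by apply/funext.
split=> [|[a aP] /fine_cvgP[_ g_0]]; last first.
  have a0 : 0 < a.+1%:R^-1 :> R by rewrite invr_gt0 ltr0n.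
  have [b _ bP] := (cvgr0Pnorm_lt g).1 g_0 _ a0; have [c bc] := aP b.
  by rewrite leNgt -(ger0_norm (g0 c)) bP.
apply: contra_notP => H; apply/fine_cvgP; split; first exact: nearW.
apply: (cvgr0Pnorm_lt g).2 => e e0.
have [a ae] : exists a, a.+1%:R^-1 < e.
  have [a _ aP] := near_infty_natSinv_lt (PosNum e0).
  by exists a; apply: aP => /=.
have [b bP] : exists b, forall c, (b <= c)%N -> g c < a.+1%:R^-1.
  apply: contrapT => nb; apply: H; exists a => b.
  apply: contrapT => nc; apply: nb; exists b => c bc.
  by rewrite ltNge; apply/negP => ac; apply: nc; exists c.
exists b => // c /= bc; rewrite ger0_norm //.
exact: lt_trans (bP _ bc) ae.
Qed.

(** Floor of (k + 1) p for the rational p coded by [z], cut off at 0: an odd numerator code stands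
    for a negative number. *)
Definition scaled_floor z k := (~~ odd (cfst z) * ((cfst z)./2 * k.+1 %/ csnd z))%N.

(** One unit of error comes from the approximation [p], one from the floor. A negative [p] forces (k
    + 1) x into [0, 1], where the value 0 is good enough. *)
Lemma scaled_floor_approx (x : R) (p : rat) k :
  0 <= x -> `|x - ratr p| <= k.+1%:R^-1 ->
  `|k.+1%:R * x - (scaled_floor (ratcode p) k)%:R| <= 2.
Proof.
move=> x0; rewrite /scaled_floor /ratcode cpairKl cpairKr => xp.
have k0 : 0 < k.+1%:R :> R by rewrite ltr0n.
have {}xp : `|k.+1%:R * x - k.+1%:R * ratr p| <= 1.
  rewrite -mulrBr normrM (gtr0_norm k0).
  by move: xp; rewrite -(ler_pM2l k0) (mulfV (lt0r_neq0 k0)).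
have d0 : (0 < `|denq p|)%N by rewrite absz_gt0 denq_neq0.
have pE : ratr p = (numq p)%:~R / `|denq p|%N%:R :> R.
  by rewrite /ratr -[(`|_|%N)%:R]/((Posz `|denq p|)%:~R) absz_denq.
move: xp; rewrite pE; case: (numq p) => n; rewrite /intcode; last first.
  have -> : odd n.*2.+1 by rewrite /= odd_double.
  rewrite mul0n subr0 => xp.
  have : k.+1%:R * ((Negz n)%:~R / `|denq p|%N%:R) <= 0 :> R.
    by rewrite pmulr_rle0 // pmulr_lle0 ?invr_gt0 ?ltr0n // lerz0.
  have : 0 <= k.+1%:R * x by rewrite mulr_ge0 // ltW.
  by move: xp; rewrite !ler_norml; lra.
rewrite odd_double mul1n doubleK => xp.
set m := (_ %/ _)%N.
have dR : 0 < `|denq p|%N%:R :> R by rewrite ltr0n.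
have e : k.+1%:R * (n%:R / `|denq p|%N%:R) = (n * k.+1)%:R / `|denq p|%N%:R :> R.
  by rewrite natrM mulrCA mulrA.
rewrite -[_%:~R]/(n%:R) e in xp.
have m1 : m%:R <= (n * k.+1)%:R / `|denq p|%N%:R :> R.
  by rewrite ler_pdivlMr // -natrM ler_nat leq_trunc_div.
have m2 : (n * k.+1)%:R / `|denq p|%N%:R <= m%:R + 1 :> R.
  by rewrite ler_pdivrMr // natr1 -natrM ler_nat ltnW // ltn_ceil.
by move: xp; rewrite !ler_norml; lra.
Qed.

(** Makes the requested precision a recursive function of [k]; the 2 is [intcode 1]. *)
Lemma ratcode_inv k : ratcode (k.+1%:R^-1) = cpair 2 k.+1.
Proof.
rewrite /ratcode.
have -> : k.+1%:R^-1 = (1 : int)%:~R / (k.+1 : int)%:~R :> rat by rewrite mul1r.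
have co : coprime `|1 : int| `|k.+1 : int| by exact: coprime1n.
by rewrite coprimeq_num // coprimeq_den // gtr0_sg.
Qed.
End Reals.

#[global] Instance rec_scaled_floor : rec2 scaled_floor.
Proof. by rewrite /scaled_floor; rec_solve. Qed.

(** * Shift-invariant and ergodic measures *)

Section Measure.
Variables (Q : finType) (q0 : Q) (R : realType) (mu : probability (QZ q0) R).
Local Notation q := #|Q|.
Local Open Scope classical_set_scope.
Local Open Scope ring_scope.

Lemma cyl_atP i (u : seq Q) (c : QZ q0) :
  cyl_at q0 i u c <-> forall k, (k < size u)%N -> c (i + k%:Z) = nth q0 u k.
Proof.
split=> [H k ku|H k]; last by rewrite H // (tnth_nth q0).
by have := H (Ordinal ku); rewrite (tnth_nth q0).
Qed.

Lemma measurable_cyl i u : measurable (cyl_at q0 i u : set (QZ q0)).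
Proof. by apply: sub_sigma_algebra; exists i, u. Qed.

Lemma sshift_cyl i u : sshift (q0:=q0) @^-1` cyl_at q0 i u = cyl_at q0 (i + 1) u.
Proof.
apply/seteqP; split=> c /cyl_atP H; apply/cyl_atP => k ku;
  by rewrite -(H k ku) /=; congr (c _); ring.
Qed.

Lemma mu_cyl_at i u : shift_invariant mu -> mu (cyl_at q0 i u) = mu (cyl0 q0 u).
Proof.
move=> inv; have step j : mu (cyl_at q0 (j + 1) u) = mu (cyl_at q0 j u).
  by rewrite -sshift_cyl; apply: inv; exact: measurable_cyl.
elim: i => [//|n <-|n <-]; first by rewrite -[RHS]step; congr (mu (cyl_at _ _ _)); lia.
by rewrite -[LHS]step; congr (mu (cyl_at _ _ _)); lia.
Qed.

Lemma mu_fine (A : set (QZ q0)) : measurable A -> mu A = (fine (mu A))%:E.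
Proof. by move=> mA; rewrite fineK // fin_num_measure. Qed.

Lemma measure_bigcap_ge (F : nat -> set (QZ q0)) e :
  (forall n, measurable (F n)) -> (forall n m, (n <= m)%N -> F m `<=` F n) ->
  (forall n, (e <= mu (F n))%E) -> (e <= mu (\bigcap_n F n))%E.
Proof.
move=> mF dF eF.
have cv : mu \o F @ \oo --> mu (\bigcap_n F n).
  apply: nonincreasing_cvg_mu => //.
  - exact: le_lt_trans (probability_le1 mu (mF 0%N)) (ltry _).
  - exact: bigcapT_measurable.
  - by move=> n m nm; apply/subsetPset; exact: dF.
by apply: (cvge_to_ge cv); exact: nearW.
Qed.

Lemma mu_le (A B : set (QZ q0)) : measurable A -> measurable B -> A `<=` B ->
  (mu A <= mu B)%E.
Proof. by move=> mA mB AB; apply: le_measure; rewrite ?inE. Qed.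

(** The sign [s] is 1 for occurrences arbitrarily far to the right and -1 for the left. *)
Definition occurs_io (w : seq Q) (s : int) : set (QZ q0) :=
  \bigcap_n \bigcup_(k in [set k | (n <= k)%N]) cyl_at q0 (s * k%:Z) w.

Lemma measurable_occurs_io w s : measurable (occurs_io w s).
Proof.
apply: bigcapT_measurable => n; apply: bigcup_measurable => k _.
exact: measurable_cyl.
Qed.

(** The event is shift-invariant, so it has measure 0 or 1. It is a decreasing intersection of
    events that each contain a translate of [w], so its measure is at least that of [w], which is
    positive. *)
Lemma mu_occurs_io w s : s = 1 \/ s = -1 ->
  shift_invariant mu -> shift_ergodic mu -> full_support mu ->
  mu (~` occurs_io w s) = 0%E.
Proof.
move=> s1 inv erg full; have mB := measurable_occurs_io w s.
rewrite probability_setC //; case: (erg _ mB) => [|mu0|->]; last first.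
- by rewrite subee.
- have : (mu (cyl0 q0 w) <= mu (occurs_io w s))%E; last first.
    by rewrite mu0 leNgt full.
  apply: measure_bigcap_ge => [n|n m nm c [k /= mk ck]|n].
  + by apply: bigcup_measurable => k _; exact: measurable_cyl.
  + by exists k => //=; exact: leq_trans mk.
  + rewrite -(mu_cyl_at (s * n%:Z)) //; apply: mu_le; first exact: measurable_cyl.
      by apply: bigcup_measurable => k _; exact: measurable_cyl.
    by move=> c cn; exists n => /=.
apply/seteqP; split=> c H n _.
(* Shifting by one cell changes the index k by [s], as s * s = 1; starting from n + 1 keeps the new
   index at least n. *)
- have [k /= nk] := H n.+1 I.
  rewrite -[cyl_at _ _ _ _]/((sshift (q0:=q0) @^-1` cyl_at q0 (s * k%:Z) w) c).
  rewrite sshift_cyl => ck; exists (absz (k%:Z + s)); first by case: s1 => -> /=; lia.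
  by case: s1 ck => ->; congr (cyl_at _ _ _ _); lia.
- have [k /= nk ck] := H n.+1 I; exists (absz (k%:Z - s)).
    by case: s1 => -> /=; lia.
  rewrite -[cyl_at _ _ _ _]/((sshift (q0:=q0) @^-1`
    cyl_at q0 (s * (absz (k%:Z - s))%:Z) w) c) sshift_cyl.
  suff -> : s * (absz (k%:Z - s))%:Z + 1 = s * k%:Z by [].
  by case: s1 => ->; lia.
Qed.
End Measure.

(** * Preimages of cylinders as finite unions of cylinders *)

Section Dynamics.
Variables (Q : finType) (q0 : Q) (r : nat) (delta : (r.*2.+1).-tuple Q -> Q).
Local Notation q := #|Q|.
Local Notation A := (ca_global (q0 := q0) delta).
Local Notation word := (word q0).
Local Notation cyc := (cyc q0 delta).

(** [n] is a word code; counting failures expresses a bounded universal quantifier by a recursive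
    sum. *)
Definition mismatches l N t i n := nsum (llen n) (fun k =>
  nat_of_bool (~~ (dig q (iter t (cyc l) N) (i + k) == lnth n k))).

Definition occurs l N t i n := mismatches l N t i n == 0.

Lemma occursP l N t i u : occurs l N t i (wordcode u) <->
  forall k, k < size u -> dig q (iter t (cyc l) N) (i + k) = rank (nth q0 u k).
Proof.
have nthE k : k < size u -> lnth (wordcode u) k = rank (nth q0 u k).
  by move=> ku; rewrite lnth_listcode (nth_map q0).
rewrite /occurs /mismatches /nsum sum_nat_eq0 llen_listcode size_map.
split=> [/forallP H k ku|H].
  have := H (Ordinal ku); rewrite /= nthE // eqb0 negbK => /eqP; exact.
by apply/forallP => -[k ku]; rewrite /= nthE // eqb0 negbK H.
Qed.

Local Open Scope classical_set_scope.
Local Open Scope ring_scope.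

Lemma occurs_per l N t i u : (0 < l)%N -> (i + size u <= l)%N ->
  occurs l N t i (wordcode u) <-> cyl_at q0 i%:Z u (iter t A (per q0 l N)).
Proof.
move=> l0 iul; rewrite iter_ca_per // occursP cyl_atP.
split=> H k ku; have := H k ku; rewrite -PoszD per_nat; try lia.
  by move=> ->; rewrite rankK.
by move=> <-; rewrite letterK // (dig_lt q0).
Qed.

Lemma exists_word l p (c : QZ q0) :
  exists2 N, (N < q ^ l)%N & cyl_at q0 p (word l N) c.
Proof.
pose v := [seq c (p + k%:Z) | k <- iota 0 l].
have sv : size v = l by rewrite size_map size_iota.
have [N Nl vN] := word_surj q0 v; rewrite sv in Nl vN.
exists N => //; rewrite vN; apply/cyl_atP => k; rewrite sv => kl.
by rewrite (nth_map 0%N) ?size_iota // nth_iota.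
Qed.

Lemma word_per l N i c : cyl_at q0 (- i%:Z) (word l N) c ->
  agree (- i%:Z) (- i%:Z + l%:Z - 1) c (shiftz i%:Z (per q0 l N)).
Proof.
move=> /cyl_atP cN z zl; pose k := absz (z + i%:Z).
have kl : (k < l)%N by rewrite /k; lia.
have zk : z + i%:Z = k%:Z by rewrite /k; lia.
rewrite -[RHS]/(per q0 l N (z + i%:Z)) zk per_nat // -(nth_word q0 N kl).
by rewrite -cN ?size_word //; congr (cval _ _); lia.
Qed.

Definition preimage_cyl t u : set (QZ q0) := iter t A @^-1` cyl0 q0 u.

(** The extra cell keeps the length positive, also for the empty word at time 0. *)
Definition window (u : seq Q) t := (size u + (r * t).*2).+1.

(** The window contains the dependence cone of the cells of [u], so [c] can be replaced by the
    periodic extension of what it shows there. *)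
Lemma preimage_cylP t u N c : let l := window u t in
  cyl_at q0 (- (r * t)%N%:Z) (word l N) c ->
  preimage_cyl t u c <-> occurs l N t (r * t) (wordcode u).
Proof.
move=> l cN; rewrite occurs_per //; last by rewrite /l /window; lia.
have ag := word_per cN.
have {}ag := agree_iter delta (t := t) ag.
rewrite /preimage_cyl /cyl0 [preimage _ _ _]/=.
rewrite !cyl_atP; split=> H k ku; have := H k ku; rewrite ag ?iter_shiftz /=;
  try (rewrite /l /window; lia);
  by move=> <-; congr (cval _ _); lia.
Qed.

Lemma preimage_cyl_bigsetU t u : let l := window u t in
  preimage_cyl t u =
  \big[setU/set0]_(N < q ^ l | occurs l N t (r * t) (wordcode u))
    cyl_at q0 (- (r * t)%N%:Z) (word l N).
Proof.
move=> l; rewrite -(big_mkord (fun N => occurs l N t (r * t) (wordcode u))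
  (fun N => cyl_at q0 (- (r * t)%N%:Z) (word l N))) -bigcup_seq_cond.
apply/seteqP; split=> [c pc|c [N /andP[Nl oN] cN]]; last exact/(preimage_cylP cN).
have [N Nl cN] := exists_word l (- (r * t)%N%:Z) c.
exists N => //=; rewrite mem_index_iota Nl; exact/(preimage_cylP cN).
Qed.

Lemma measurable_preimage_cyl t u : measurable (preimage_cyl t u).
Proof.
rewrite preimage_cyl_bigsetU; apply: bigsetU_measurable => N _.
exact: measurable_cyl.
Qed.

Variables (R : realType) (mu : probability (QZ q0) R).
Hypothesis mu_inv : shift_invariant mu.

Lemma mu_preimage_cyl t u : let l := window u t in
  fine (mu (preimage_cyl t u)) =
  \sum_(N < q ^ l | occurs l N t (r * t) (wordcode u))
    fine (mu (cyl0 q0 (word l N))).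
Proof.
move=> l; rewrite preimage_cyl_bigsetU measure_bigsetU_ord_cond.
- rewrite -sum_fine; last by move=> N _; apply: fin_num_measure; exact: measurable_cyl.
  by apply: eq_bigr => N _; congr fine; exact: mu_cyl_at.
- by move=> N _; exact: measurable_cyl.
(* Disjointness: a common configuration would show both words at the same place, and numbers below
   q^l are determined by their words. *)
- move=> N N' _ _ [c [/cyl_atP cN /cyl_atP cN']]; apply/val_inj.
  apply: (@word_inj _ q0 l _ _ (ltn_ord N) (ltn_ord N')).
  rewrite size_word in cN; rewrite size_word in cN'.
  apply: (@eq_from_nth _ q0); rewrite !size_word // => k kl.
  by rewrite -cN // -cN'.
Qed.

Lemma limit_languageP u : limit_language delta mu u <->
  exists a : nat, forall b, exists2 t, (b <= t)%N &
    a.+1%:R^-1 <= fine (mu (preimage_cyl t u)).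
Proof.
apply: (not_cvge0P (g := fun t => fine (mu (preimage_cyl t u)))) => t.
  by rewrite -mu_fine //; exact: measurable_preimage_cyl.
by apply: fine_ge0.
Qed.
End Dynamics.

(** * Integer approximations of a computable measure *)

Section Computable.
Variables (Q : finType) (q0 : Q) (R : realType) (mu : probability (QZ q0) R).
Local Notation q := #|Q|.
Local Open Scope ring_scope.

Lemma computable_approx : computable_measure mu ->
  exists M : nat -> nat -> nat -> nat, rec3 M /\ forall l N k,
    `|k.+1%:R * fine (mu (cyl0 q0 (word q0 l N))) - (M l N k)%:R| <= 2.
Proof.
case=> p pP.
have ex l N k : exists z, peval p [:: numcode Q l N; cpair 2 k.+1] z /\
    `|k.+1%:R * fine (mu (cyl0 q0 (word q0 l N))) - (scaled_floor z k)%:R| <= 2.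
  have k0 : 0 < k.+1%:R^-1 :> rat by rewrite invr_gt0 ltr0n.
  have [z [ev zP]] := pP (word q0 l N) _ k0; exists (ratcode z); split.
    by rewrite (numcodeE q0) -ratcode_inv.
  apply: scaled_floor_approx; first exact: fine_ge0.
  move: zP; rewrite mu_fine; last exact: measurable_cyl.
  by rewrite -EFinB lee_fin [ratr k.+1%:R^-1]fmorphV /= ratr_nat.
(* [f] is defined by choice, but each chosen value is an output of [p], so [p] composed with the
   codes of its inputs computes [f]. *)
pose f l N k := sval (cid (ex l N k)).
have [pn pnP] : recursive 3 (fun v => numcode Q (nth 0%N v 0) (nth 0%N v 1)).
  by rec_solve.
have [pk pkP] : recursive 3 (fun v => cpair 2 (nth 0%N v 2).+1) by rec_solve.
have rf : rec3 f.
  exists (PComp p [:: pn; pk]) => v sv; econstructor.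
    econstructor; first exact: pnP.
    by econstructor; [exact: pkP|constructor].
  by rewrite /f; case: cid => z [].
exists (fun l N k => scaled_floor (f l N k) k); split; first by rec_solve.
by move=> l N k; rewrite /f; case: cid => z [].
Qed.
End Computable.

(** * The limit language of a computable measure *)

Section Part1.
Variables (Q : finType) (q0 : Q) (r : nat) (delta : (r.*2.+1).-tuple Q -> Q).
Variables (R : realType) (mu : probability (QZ q0) R).
Hypothesis mu_inv : shift_invariant mu.
Local Notation q := #|Q|.
Local Open Scope ring_scope.

Lemma computable_Sigma03 :
  computable_measure mu -> Sigma03_words (limit_language delta mu).
Proof.
case/computable_approx => M [rM MP].
pose len n t := (llen n + (r * t).*2).+1.
pose S n t k := nsum (q ^ len n t) (fun N =>
  occurs q0 delta (len n t) N t (r * t) n * M (len n t) N k)%N.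
(* Write X = q^l. The sum [S] approximates (K + 1) mu(A^-t [u]) within 2X, an error of 2 per word. A
   measure >= 1/(a + 1) gives S >= 8X - 2X, above the threshold 4X; conversely S >= 4X gives (K + 1)
   mu(A^-t [u]) >= 2X. *)
pose K n a t := (8 * a.+1 * q ^ len n t)%N.
pose Rel n a b c := (b <= c)%N && (4 * q ^ len n c <= S n c (K n a c))%N.
have SP u t k :
    `|k.+1%:R * fine (mu (preimage_cyl delta t u)) - (S (wordcode u) t k)%:R|
    <= 2 * (q ^ window r u t)%:R :> R.
  have lenE : len (wordcode u) t = window r u t.
    by rewrite /len llen_listcode size_map.
  rewrite /S lenE mu_preimage_cyl // /nsum; move: (window r u t) => l /=.
  rewrite natr_sum big_mkcond /= mulr_sumr -sumrB.
  apply: le_trans (ler_norm_sum _ _ _) _.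
  apply: (@le_trans _ _ (\sum_(N < q ^ l) 2)); last first.
    by rewrite sumr_const card_ord mulr_natr.
  apply: ler_sum => N _; case: ifP => _; first by rewrite mul1n.
  by rewrite mul0n mulr0 subr0 normr0.
exists Rel; split.
  have [p pP] : rec4 (fun n a b c => nat_of_bool (Rel n a b c)).
    by rewrite /Rel /S /K /len /occurs /mismatches; rec_solve.
  by exists p => n a b c; exact: (pP [:: n; a; b; c]).
move=> u; rewrite limit_languageP //.
have lenE t : len (wordcode u) t = window r u t.
  by rewrite /len llen_listcode size_map.
have q_gt0 t : 0 < (q ^ window r u t)%:R :> R.
  by rewrite ltr0n expn_gt0 (alphabet_gt0 q0).
split=> -[a aP].
  exists a => b; have [t bt gt] := aP b; exists t.
  rewrite /Rel bt /K lenE /=.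
  have := SP u t (8 * a.+1 * q ^ window r u t)%N.
  move: (q_gt0 t) gt; set g := fine _; set X := (q ^ _)%N; set s := S _ _ _.
  rewrite -(ler_nat R) natrM -[(8 * _ * X).+1%:R]natr1 2!natrM ler_norml => X0 ga /andP[_ H].
  have a0 : 0 < a.+1%:R :> R by rewrite ltr0n.
  have : 1 <= a.+1%:R * g by rewrite -ler_pdivrMl // mulr1.
  have g0 : 0 <= g by exact: fine_ge0.
  move=> ag; have : 8%:R * X%:R <= 8%:R * a.+1%:R * X%:R * g.
    by nra.
  by move: H; nra.
(* Since K + 1 <= 10 (a + 1) X, the lower bound 2X yields a measure of at least 1/(5 (a + 1)). *)
exists (5 * a.+1).-1 => b; have [t] := aP b; rewrite /Rel /K lenE => /andP[bt H].
exists t => //; have := SP u t (8 * a.+1 * q ^ window r u t)%N.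
move: (q_gt0 t) H; set g := fine _; set X := (q ^ _)%N; set s := S _ _ _.
rewrite -(ler_nat R) natrM -[(8 * _ * X).+1%:R]natr1 2!natrM ler_norml => X0 H /andP[H' _].
have -> : (5 * a.+1).-1.+1 = (5 * a.+1)%N by lia.
have a0 : 1 <= a.+1%:R :> R by rewrite ler1n.
have X1 : 1 <= X%:R :> R by rewrite ler1n -(ltr0n R).
rewrite natrM -div1r ler_pdivrMr; last by nra.
have g0 : 0 <= g by exact: fine_ge0.
have : 2%:R * X%:R <= (8%:R * a.+1%:R * X%:R + 1) * g by nra.
have : (8%:R * a.+1%:R * X%:R + 1) * g <= (10%:R * a.+1%:R * X%:R) * g.
  by apply: ler_wpM2r => //; nra.
move=> H1 H2; have H3 : 2%:R * X%:R <= (10%:R * a.+1%:R * g) * X%:R.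
  by apply: le_trans H2 _; apply: le_trans H1 _; rewrite mulrAC.
by move: H3; rewrite ler_pM2r //; lra.
Qed.
End Part1.

(** * Blocking words *)

Section Walls.
Variables (Q : finType) (q0 : Q) (r : nat) (delta : (r.*2.+1).-tuple Q -> Q).
Local Notation q := #|Q|.
Local Notation A := (ca_global (q0 := q0) delta).
Local Notation word := (word q0).
Local Notation cyc := (cyc q0 delta).
Local Open Scope classical_set_scope.
Local Open Scope ring_scope.

Variables (x : QZ q0) (m : nat).
Hypothesis xm : forall y : QZ q0,
  (forall i : int, `|i| <= m%:Z -> y i = x i) ->
  forall (t : nat) (i : int), `|i| <= r%:Z -> iter t A y i = iter t A x i.

(** The central word x[-m, m]. By [xm] it determines for all times the 2r + 1 cells around its
    centre, a band that no influence crosses in one step. *)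
Definition wall : seq Q := [seq x (k%:Z - m%:Z) | k <- iota 0 m.*2.+1].

Lemma size_wall : size wall = m.*2.+1.
Proof. by rewrite size_map size_iota. Qed.

(** Translating [c] by p + m centres the wall at the origin, where [xm] applies. *)
Lemma iter_at_wall c p t z : cyl_at q0 p wall c ->
  `|z - (p + m%:Z)| <= r%:Z -> iter t A c z = iter t A x (z - (p + m%:Z)).
Proof.
move=> /cyl_atP cw zr; rewrite -(xm (y := shiftz (p + m%:Z) c)) // => [|i im].
  by rewrite iter_shiftz /=; congr (cval _ _); lia.
pose k := absz (i + m%:Z); have km : (k < m.*2.+1)%N by rewrite /k; lia.
have := cw k; rewrite size_wall => /(_ km).
rewrite (nth_map 0%N) ?size_iota // nth_iota // => H.
have -> : x i = x ((0 + k)%N%:Z - m%:Z) by congr (cval _ _); rewrite /k; lia.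
by rewrite -H /=; congr (cval _ _); rewrite /k; lia.
Qed.

(** Induction on time. Cells within [r] of a wall centre are dictated by [x]; any other cell has its
    whole neighbourhood between the two centres, where the induction hypothesis applies. *)
Lemma iter_between_walls c c' p p' t : p <= p' ->
  cyl_at q0 p wall c -> cyl_at q0 p wall c' ->
  cyl_at q0 p' wall c -> cyl_at q0 p' wall c' ->
  agree p (p' + m.*2%:Z) c c' ->
  agree (p + m%:Z - r%:Z) (p' + m%:Z + r%:Z) (iter t A c) (iter t A c').
Proof.
move=> pp' cp c'p cp' c'p' ag; elim: t => [|t IH] z zp.
all: have [zl|zl] := leP `|z - (p + m%:Z)| r%:Z;
  first by rewrite (iter_at_wall _ cp zl) (iter_at_wall _ c'p zl).
all: have [zr|zr] := leP `|z - (p' + m%:Z)| r%:Z;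
  first by rewrite (iter_at_wall _ cp' zr) (iter_at_wall _ c'p' zr).
  by apply: ag; lia.
by apply: ca_local => k kr; apply: IH; lia.
Qed.

(** The pattern begins and ends with the wall, and the word coded by [n], put at offset [i], fits
    between the wall centres m and l - m - 1. *)
Definition walled l N i n := [&& (m.*2 < l)%N, (N < q ^ l)%N,
  occurs q0 delta l N 0 0 (wordcode wall),
  occurs q0 delta l N 0 (l - m.*2.+1) (wordcode wall),
  (m <= i)%N & (i + llen n + m <= l)%N].

Lemma agree_cyl a b c c' i u : agree a b c c' -> a <= i ->
  i + (size u)%:Z <= b + 1 -> cyl_at q0 i u c -> cyl_at q0 i u c'.
Proof.
move=> cc' ai ib /cyl_atP cu; apply/cyl_atP => k ku.
by rewrite -cu // cc' //; lia.
Qed.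

Lemma cyl_at_shiftz p i u c :
  cyl_at q0 i u (shiftz p c) <-> cyl_at q0 (i + p) u c.
Proof.
by rewrite !cyl_atP; split=> H k ku; rewrite -H //=; congr (cval _ _); lia.
Qed.

(** [c] and the translated periodic extension of the pattern share both walls and everything between
    them, so they show the same cells at the place of [u] at every time. *)
Lemma walledP l N i u t c : walled l N i (wordcode u) ->
  cyl_at q0 (- i%:Z) (word l N) c ->
  preimage_cyl delta t u c <-> occurs q0 delta l N t i (wordcode u).
Proof.
rewrite /walled llen_listcode size_map => /and5P[ml Nl o1 o2 /andP[mi iul]] cN.
rewrite occurs_per; try lia.
have w1 : cyl_at q0 0 wall (per q0 l N).
  by move: o1; rewrite occurs_per ?size_wall //; lia.
have w2 : cyl_at q0 (l - m.*2.+1)%N%:Z wall (per q0 l N).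
  by move: o2; rewrite occurs_per ?size_wall //; lia.
have ag := word_per cN.
have ag' : agree (- i%:Z) (- i%:Z + l%:Z - 1) (shiftz i%:Z (per q0 l N)) c.
  by move=> z zl; rewrite ag.
pose p' := - i%:Z + (l - m.*2.+1)%N%:Z.
have w1' : cyl_at q0 (- i%:Z) wall (shiftz i%:Z (per q0 l N)).
  by apply/cyl_at_shiftz; rewrite addNr.
have w2' : cyl_at q0 p' wall (shiftz i%:Z (per q0 l N)).
  by apply/cyl_at_shiftz; rewrite /p' addrAC addNr add0r.
have c1 := agree_cyl ag' _ _ w1'; have c2 := agree_cyl ag' _ _ w2'.
rewrite size_wall in c1; rewrite size_wall in c2.
have {}ag : agree (- i%:Z) (p' + m.*2%:Z) c (shiftz i%:Z (per q0 l N)).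
  by move=> z zl; apply: ag; rewrite /p' in zl; lia.
have ag2 := iter_between_walls t _ (c1 _ _) w1' (c2 _ _) w2' ag.
have {}ag2 : agree 0 ((size u)%:Z - 1) (iter t A c)
    (iter t A (shiftz i%:Z (per q0 l N))).
  move=> z zu; apply: ag2; rewrite /p'; lia.
have -> : cyl_at q0 i%:Z u (iter t A (per q0 l N)) <->
    cyl_at q0 0 u (iter t A (shiftz i%:Z (per q0 l N))).
  by rewrite iter_shiftz cyl_at_shiftz add0r.
rewrite /preimage_cyl /cyl0 [preimage _ _ _]/=.
by split; [apply: agree_cyl ag2 _ _|apply: (@agree_cyl 0 ((size u)%:Z - 1));
  [by move=> z zu; rewrite ag2|..]]; lia.
Qed.

(** [y] codes the quadruple (l, N, t, i). The bound q^l <= t places time t on the cycle of the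
    pattern. *)
Definition certificate y n :=
  let l := cfst y in let N := cfst (csnd y) in
  let t := cfst (csnd (csnd y)) in let i := csnd (csnd (csnd y)) in
  [&& walled l N i n, (q ^ l <= t)%N & occurs q0 delta l N t i n].

Lemma rec_certificate : rec2 (fun y n => nat_of_bool (certificate y n)).
Proof. by rewrite /certificate /walled /occurs /mismatches; rec_solve. Qed.

(** The pattern is read off [c], from the start of the left wall to the end of the right one. *)
Lemma walled_cover c (u : seq Q) j k : cyl_at q0 (- j%:Z) wall c -> cyl_at q0 k%:Z wall c ->
  (m <= j)%N -> (size u <= k)%N ->
  exists N, let l := (j + k + m.*2.+1)%N in
    walled l N j (wordcode u) /\ cyl_at q0 (- j%:Z) (word l N) c.
Proof.
move=> cj ck mj uk; set l := (j + k + m.*2.+1)%N.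
have [N Nl cN] := exists_word l (- j%:Z) c.
exists N; split=> //; rewrite /walled llen_listcode size_map Nl mj.
have ag := word_per cN.
have l0 : (0 < l)%N by rewrite /l; lia.
have -> : (m.*2 < l)%N by rewrite /l; lia.
have -> : (j + size u + m <= l)%N by rewrite /l; lia.
rewrite /= andbT; apply/andP; split.
  rewrite occurs_per // ?size_wall; last by rewrite /l; lia.
  rewrite -[0%:Z](addNr j%:Z) -cyl_at_shiftz.
  apply: agree_cyl ag _ _ cj; rewrite ?size_wall /l; lia.
rewrite occurs_per // ?size_wall; last by rewrite /l; lia.
have -> : (l - m.*2.+1)%N%:Z = k%:Z + j%:Z by rewrite /l; lia.
rewrite -cyl_at_shiftz.
by apply: agree_cyl ag _ _ ck; rewrite ?size_wall /l; lia.
Qed.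

(** * Certificates characterise the limit language *)

Variables (R : realType) (mu : probability (QZ q0) R).
Hypotheses (mu_inv : shift_invariant mu) (mu_full : full_support mu).

(** The pattern has positive measure by full support, and every configuration carrying it shows [u]
    again at all times t + bP; hence the measures stay above a fixed threshold infinitely often. *)
Lemma certificate_sound y u : certificate y (wordcode u) ->
  limit_language delta mu u.
Proof.
rewrite /certificate; set l := cfst y; set N := cfst (csnd y).
set t := cfst _; set i := csnd (csnd (csnd y)).
case/and3P => wal tl occ; rewrite limit_languageP //.
have mW : 0 < fine (mu (cyl0 q0 (word l N))).
  apply: fine_gt0; rewrite mu_full /=.
  exact: le_lt_trans (probability_le1 mu (measurable_cyl _ _)) (ltry _).
have [a aW] : exists a, a.+1%:R^-1 < fine (mu (cyl0 q0 (word l N))).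
  have [a _ aP] := near_infty_natSinv_lt (PosNum mW).
  by exists a; apply: aP => /=.
have Nl : (N < q ^ l)%N by case/and5P: wal.
exists a => b; have [P P0 cycP] := cyc_recurrent q0 delta Nl tl.
exists (t + b * P)%N; first by rewrite (leq_trans _ (leq_addl _ _)) // leq_pmulr.
apply: (le_trans (ltW aW)); apply: fine_le; rewrite ?fin_num_measure //.
- exact: measurable_cyl.
- exact: measurable_preimage_cyl.
- rewrite -(mu_cyl_at (- i%:Z)) //; apply: mu_le.
  + exact: measurable_cyl.
  + exact: measurable_preimage_cyl.
  + move=> c cN; apply/(walledP _ wal cN).
    by move: occ; rewrite /occurs /mismatches cycP.
Qed.

Hypothesis mu_erg : shift_ergodic mu.

(** Without a certificate, late preimages of [u] avoid every configuration with walls near the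
    origin on both sides. The complements of these events [G n] would then all have measure at least
    1/(a + 1), although their intersection is null by ergodicity. *)
Lemma certificate_complete u : limit_language delta mu u ->
  exists y, certificate y (wordcode u).
Proof.
rewrite limit_languageP // => -[a aP]; apply: contrapT => nocert.
pose G n : set (QZ q0) :=
  \bigcup_(j in [set j | (m <= j <= n)%N])
  \bigcup_(k in [set k | (size u <= k <= n)%N])
    (cyl_at q0 (- j%:Z) wall `&` cyl_at q0 k%:Z wall).
have mG n : measurable (G n).
  apply: bigcup_measurable => j _; apply: bigcup_measurable => k _.
  by apply: measurableI; exact: measurable_cyl.
have muG n : (a.+1%:R^-1%:E <= mu (~` G n))%E.
  (* A pattern found in [G n] has length j + k + 2m + 1 <= 2n + 2m + 1, so this time exceeds its
     q^l. *)
  have [t tn gt] := aP (q ^ (n.*2 + m.*2.+1))%N.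
  have le : (a.+1%:R^-1%:E <= mu (preimage_cyl delta t u))%E.
    by rewrite mu_fine ?lee_fin //; exact: measurable_preimage_cyl.
  apply: le_trans le _; apply: mu_le.
  - exact: measurable_preimage_cyl.
  - exact: measurableC.
  move=> c ct [j /= /andP[mj jn] [k /= /andP[uk kn] [cj ck]]].
  have [N [wal cN]] := walled_cover cj ck mj uk.
  (* The pattern starts at cell -j, so the origin has offset [j] in it. *)
  apply: nocert; exists (cpair (j + k + m.*2.+1) (cpair N (cpair t j))).
  rewrite /certificate !(cpairKl, cpairKr) wal /=; apply/andP; split.
    by apply: leq_trans tn; rewrite leq_pexp2l ?(alphabet_gt0 q0) //; lia.
  by apply/(walledP t wal cN).
have : (a.+1%:R^-1%:E <= mu (\bigcap_n ~` G n))%E.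
  apply: measure_bigcap_ge => [n|n n' nn' c|//]; first exact: measurableC.
  apply: contra_not => -[j /= /andP[mj jn] [k /= /andP[uk kn] ck]].
  exists j => /=; first by rewrite mj (leq_trans jn).
  by exists k => //=; rewrite uk (leq_trans kn).
have mB s : measurable (~` occurs_io (q0 := q0) wall s).
  by apply: measurableC; exact: measurable_occurs_io.
have : (mu (\bigcap_n ~` G n) <=
        mu (~` occurs_io (q0 := q0) wall (-1) `|` ~` occurs_io wall 1))%E.
  apply: mu_le => //.
  - by apply: bigcapT_measurable => n; exact: measurableC.
  - exact: measurableU.
  move=> c nG; rewrite -setCI => -[l1 r1].
  have [j mj cj] := l1 m I; have [k uk ck] := r1 (size u) I.
  apply: (nG (maxn j k) I); exists j; first by rewrite /= mj leq_maxl.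
  exists k; first by rewrite /= uk leq_maxr.
  by move: cj ck; rewrite mulN1r mul1r.
move=> le1 le2; have := le_trans le2 le1.
have : (mu (~` occurs_io (q0 := q0) wall (-1) `|` ~` occurs_io wall 1) <=
    mu (~` occurs_io (q0 := q0) wall (-1)) +
    mu (~` occurs_io (q0 := q0) wall 1))%E by exact: measureU2.
rewrite !mu_occurs_io ?adde0 //; [|by left|by right].
move=> le3 le4; have := le_trans le4 le3.
by rewrite lee_fin leNgt invr_gt0 ltr0n.
Qed.
End Walls.

Theorem theorem3 (Q : finType) (q0 : Q) (r : nat)
  (delta : (r.*2.+1).-tuple Q -> Q) (R : realType)
  (mu : probability (QZ q0) R) :
  shift_invariant mu ->
  (computable_measure mu -> Sigma03_words (limit_language delta mu)) /\
  (shift_ergodic mu -> full_support mu ->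
   (exists x : QZ q0, equicontinuity_point delta x) ->
   RE_words (limit_language delta mu)).
Proof.
move=> inv; split; first exact: computable_Sigma03.
(* Equicontinuity is used at radius [r], the width needed for a blocking band. *)
move=> erg full [x /(_ r) [m xm]].
have [p pP] := mu_search (rec_certificate delta x m).
exists p => u; rewrite -pP; split; first exact: certificate_complete.
by case=> y; exact: certificate_sound.
Qed.
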